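(* Let $\Delta=\operatorname{conv}\{\alpha(0),\dots,\alpha(n)\}\subset\mathbb{R}^n$ be an $n$-dimensional lattice simplex with all $\alpha(j)\in(2\mathbb{N})^n$ such that $\frac12\Delta=M\Delta'$ for a lattice simplex $\Delta'\subset\mathbb{R}^n$ and an integer $M\ge n$. Then $\Delta$ is an $H$-simplex.
   Context: $\mathbb{N}=\{0,1,2,\dots\}$. Let $\hat\Delta$ be the vertex set of $\Delta$. For $L\subseteq\Delta\cap\mathbb{Z}^n$ put $\overline{A}(L)=\{\tfrac12(s+t)\in\mathbb{Z}^n: s\ne t,\ s,t\in L\cap(2\mathbb{Z})^n\}$. $L$ is $\hat\Delta$-mediated if $\hat\Delta\subseteq L\subseteq\overline{A}(L)\cup\hat\Delta$. $\Delta^*$ denotes the (unique) maximal $\hat\Delta$-mediated set, which contains every $\hat\Delta$-mediated set. $\Delta$ is an $H$-simplex if $\Delta^*=\Delta\cap\mathbb{Z}^n$, i.e. every lattice point of $\Delta$ other than the vertices is the midpoint of two distinct even lattice points of $\Delta$. *)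

(* Defs.v *)
From HB Require Import structures.
From mathcomp Require Import all_boot all_order all_algebra.
From mathcomp Require Import boolp classical_sets reals.

Set Implicit Arguments.
Unset Strict Implicit.
Unset Printing Implicit Defensive.

Import Order.TTheory GRing.Theory Num.Theory.
Local Open Scope classical_set_scope.
Local Open Scope ring_scope.

Section Lattice.
Variables (R : realType) (n : nat).
Local Notation V := 'rV[R]_n.

Definition Zpoints : set V := [set x | x \is a mxOver Num.int].
Definition Npoints : set V := [set x | x \is a mxOver Num.nat].

Definition dilate (a : R) (S : set V) : set V := [set a *: x | x in S].

Definition conv d (a : 'I_d.+1 -> V) : set V :=
  [set x | exists c : 'I_d.+1 -> R,
     [/\ forall j, 0 <= c j, \sum_j c j = 1 & x = \sum_j c j *: a j]].

Definition affinely_independent d (a : 'I_d.+1 -> V) : Prop :=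
  row_free (\matrix_(i < d) (a (lift ord0 i) - a ord0)).

(* The dimension d of a lattice simplex in R^n is not prescribed. *)
Definition lattice_simplex (S : set V) : Prop :=
  exists d, exists a : 'I_d.+1 -> V,
    [/\ forall j, Zpoints (a j), affinely_independent a & S = conv a].

(* Midpoints: the elements of Z^n of the form (s + t)/2, with s <> t in
   L /\ (2Z)^n. *)
Definition Abar (L : set V) : set V :=
  [set x | Zpoints x /\ exists s t : V,
     [/\ (L `&` dilate 2 Zpoints) s, (L `&` dilate 2 Zpoints) t,
         s <> t & x = 2^-1 *: (s + t)]].

(* D plays the role of the simplex, W that of its vertex set. *)
Definition mediated (D W L : set V) : Prop :=
  [/\ L `<=` D `&` Zpoints, W `<=` L & L `<=` Abar L `|` W].

(* The maximal mediated set, as the union of all mediated sets;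
   see max_mediatedP. *)
Definition max_mediated (D W : set V) : set V :=
  [set x | exists2 L, mediated D W L & L x].

Lemma max_mediatedP (D W : set V) : W `<=` D `&` Zpoints ->
  mediated D W (max_mediated D W) /\
  (forall L, mediated D W L -> L `<=` max_mediated D W).
Proof.
move=> WD; split; last by move=> L mL x Lx; exists L.
have mW : mediated D W W by split=> // x Wx; right.
split=> [x [L [LD _ _]] /LD//|x Wx|x [L mL Lx]]; first by exists W.
have sub y : L y -> max_mediated D W y by exists L.
have [_ _ LA] := mL; case: (LA _ Lx) => [[Zx [s [t [[Ls es] [Lt et] st xE]]]]|Wx].
  by left; split=> //; exists s, t; split=> //; split=> //; exact: sub.
by right.
Qed.

(* The vertices of the simplex conv a, for a affinely independent, are the
   points a j. *)
Definition H_simplex d (a : 'I_d.+1 -> V) : Prop :=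
  max_mediated (conv a) (range a) = conv a `&` Zpoints.

End Lattice.

(* Main.v *)
Require Import Defs.
From mathcomp Require Import all_boot all_order all_algebra.
From mathcomp Require Import archimedean boolp classical_sets reals.
From mathcomp Require Import zify ring lra.
Import Order.TTheory GRing.Theory Num.Theory.
Local Open Scope classical_set_scope.
Local Open Scope ring_scope.

(** The vertices of [conv alpha] are extreme points, so each of them is [2 M]
times a lattice point [beta j] ([dilated_vertex]).  Let [x] be a lattice
point of [conv alpha], with barycentric coordinates [c j].  In terms of the
[beta j] it has nonnegative coefficients [2 M c_j] of total weight [2 M].
Rounding these [n + 1] numbers down loses less than [n + 1] in total, so, as
[n <= M], the integer parts have total weight at least [M].  One can thus split
off natural numbers [g_j <= 2 M c_j] of total weight exactly [M]
([integral_half]), and [x] is the sum of the lattice point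
[\sum_j g_j beta_j] and of a complement, which is then a lattice point too.
In both the [beta_j] have nonnegative coefficients of total weight [M], so both
lie in half the simplex, and their doubles are even lattice points of the
simplex with midpoint [x].

The doubles coincide only if [g_j = M c_j] for all [j].  Unless [x] is a
vertex, two of the [g_j] are then positive, and moving one unit of weight from
one to the other separates the two points ([proper_integral_half]). *)

Lemma exists_nat_sum_eq (I : finType) (f : I -> nat) (N : nat) :
  (N <= \sum_i f i)%N ->
  exists2 g : I -> nat, (forall i, (g i <= f i)%N) & (\sum_i g i = N)%N.
Proof.
elim: N => [_|N IHN ltN]; first by exists (fun=> 0%N); rewrite ?big1.
have [g gf sg] := IHN (ltnW ltN).
have [i gi] : exists i, (g i < f i)%N.
  apply/existsP; apply: contraTT ltN => /existsPn fg.
  by rewrite -leqNgt -sg; apply: leq_sum => i _; rewrite leqNgt fg.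
exists (fun j => g j + (j == i))%N => [j|].
  by case: eqP => [->|_]; rewrite ?addn1 ?addn0.
by rewrite big_split /= sg (bigD1 i) //= eqxx big1 ?addn1 // => j /negbTE ->.
Qed.

Section Splitting.
Variables (R : realType) (n M : nat) (c : 'I_n.+1 -> R).
Hypotheses (leqnM : (n <= M)%N) (c0 : forall j, 0 <= c j) (c1 : \sum_j c j = 1).

(** Each of the [n + 1] numbers [2 M c_j] loses less than [1] when rounded down,
so the integer parts sum to more than [2 M - (n + 1)], hence to at least
[2 M - n >= M]. *)
Lemma integral_half : exists2 g : 'I_n.+1 -> nat,
  forall j, (g j)%:R <= (2 * M)%:R * c j & (\sum_j g j = M)%N.
Proof.
pose f j := Num.truncn ((2 * M)%:R * c j).
have lt2M : (2 * M < \sum_j (f j).+1)%N.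
  rewrite -(ltr_nat R) natr_sum -[ltLHS]mulr1 -[X in _ * X < _]c1 mulr_sumr.
  apply: ltr_sum => [|j _]; last exact: truncnS_gt.
  by apply/hasP; exists ord0; rewrite ?mem_index_enum.
have leM : (M <= \sum_j f j)%N.
  move: lt2M; under eq_bigr do rewrite -addn1.
  rewrite big_split /= sum1_card card_ord; lia.
have [g gf sg] := exists_nat_sum_eq _ f M leM.
exists g => // j; apply: (@le_trans _ _ (f j)%:R); first by rewrite ler_nat.
by rewrite truncn_le mulr_ge0.
Qed.

(** The last clause makes the two halves of [2 M c] distinct.  If the first
choice of [g] is exactly [M c], then two of its values are positive, as no [c_j]
is [1]; the slack in [g_j <= 2 g_j] then leaves room to move a unit from one
index to the other. *)
Lemma proper_integral_half : (0 < M)%N -> (forall j, c j != 1) ->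
  exists g : 'I_n.+1 -> nat,
    [/\ forall j, (g j)%:R <= (2 * M)%:R * c j, (\sum_j g j = M)%N &
        exists j, (g j)%:R != M%:R * c j].
Proof.
move=> M0 cN1; have [g gc sg] := integral_half.
have [[j gj]|gE] := pselect (exists j, (g j)%:R != M%:R * c j).
  by exists g; split=> //; exists j.
have {}gE j : M%:R * c j = (g j)%:R.
  by apply/eqP; rewrite eq_sym; apply/negPn/negP => gj; apply: gE; exists j.
have [i gi] : exists i, (0 < g i)%N.
  apply/existsP; apply: contraTT M0 => /existsPn g0.
  by rewrite -leqNgt -sg big1 // => i _; move: (g0 i); case: (g i).
have gltM : (g i < M)%N.
  rewrite ltn_neqAle -{2}sg (bigD1 i) //= leq_addr andbT.
  apply: contra (cN1 i) => /eqP giM; apply/eqP.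
  apply: (@mulfI _ (M%:R : R)); first by rewrite pnatr_eq0 -lt0n.
  by rewrite gE giM mulr1.
have [k ki gk] : exists2 k, k != i & (0 < g k)%N.
  apply/exists_inP; apply: contraTT gltM => /exists_inPn g0.
  rewrite -leqNgt -sg (bigD1 i) //= big1 ?addn0 // => j ji.
  by have := g0 j ji; case: (g j).
exists (fun j => g j + (j == i) - (j == k))%N; split.
- move=> j; rewrite natrM -mulrA gE -natrM ler_nat.
  case: (eqVneq j i) => [->|_]; last by lia.
  by rewrite [i == k]eq_sym (negbTE ki); lia.
- apply: (@addIn 1%N); rewrite -[in RHS]sg.
  have sum_delta l : (\sum_(j < n.+1) (j == l) = 1)%N.
    by rewrite (bigD1 l) //= eqxx big1 // => j /negbTE ->.
  rewrite -[in LHS](sum_delta k) -[in RHS](sum_delta i) -!big_split /=.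
  by apply: eq_bigr => j _; case: (eqVneq j k) => [->|_]; lia.
- exists i; rewrite gE eqxx [i == k]eq_sym (negbTE ki) eqr_nat; lia.
Qed.

End Splitting.

Section Barycentric.
Variables (R : realType) (n : nat).
Implicit Type d : nat.

(** Barycentric coordinates are unique: as the differences [c_j - e_j] sum to
[0], their combination of the [a_j] is one of the [a_j - a_0], with [j > 0]. *)
Lemma affinely_independent_coef d (a : 'I_d.+1 -> 'rV[R]_n)
    (c e : 'I_d.+1 -> R) :
  affinely_independent a -> \sum_j c j = \sum_j e j ->
  \sum_j c j *: a j = \sum_j e j *: a j -> forall j, c j = e j.
Proof.
move=> aI sce ce.
have sumB : \sum_j (c j - e j) = 0 by rewrite sumrB sce subrr.
have sumBa : \sum_j (c j - e j) *: a j = 0.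
  by under eq_bigr do rewrite scalerBl; rewrite sumrB ce subrr.
have lift_eq i : c (lift ord0 i) = e (lift ord0 i).
  pose v : 'rV[R]_d := \row_k (c (lift ord0 k) - e (lift ord0 k)).
  suff /rowP/(_ i) : v = 0 by rewrite !mxE => /eqP; rewrite subr_eq0 => /eqP.
  apply: (row_free_inj aI); rewrite mul0mx mulmx_sum_row.
  under eq_bigr do rewrite rowK mxE scalerBr.
  rewrite sumrB -scaler_suml.
  move: sumB; rewrite big_ord_recl /= => /eqP; rewrite addrC addr_eq0 => /eqP ->.
  by move: sumBa; rewrite big_ord_recl /= scaleNr opprK addrC.
move=> j; case: (unliftP ord0 j) => [i ->|->]; first exact: lift_eq.
move: sce; rewrite !big_ord_recl.
by under eq_bigr do rewrite lift_eq; move/addIr.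
Qed.

Lemma convex_coef_le1 d (c : 'I_d.+1 -> R) j :
  (forall i, 0 <= c i) -> \sum_i c i = 1 -> c j <= 1.
Proof. by move=> c0 <-; rewrite (bigD1 j) //= lerDl sumr_ge0. Qed.

Lemma convex_coef_eq1 d (a : 'I_d.+1 -> 'rV[R]_n) (c : 'I_d.+1 -> R) j :
  (forall i, 0 <= c i) -> \sum_i c i = 1 -> c j = 1 ->
  \sum_i c i *: a i = a j.
Proof.
move=> c0 c1 cj1; rewrite (bigD1 j) //= cj1 scale1r big1 ?addr0 // => i ij.
suff -> : c i = 0 by rewrite scale0r.
move: c1; rewrite (bigD1 j) //= cj1 => /(canRL (addKr _)); rewrite addNr.
by move=> /psumr_eq0P -> // k _.
Qed.

Lemma sum_delta d (j : 'I_d) : \sum_(i < d) (i == j)%:R = 1 :> R.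
Proof. by rewrite (bigD1 j) //= eqxx big1 ?addr0 // => i /negbTE ->. Qed.

Lemma sum_delta_scale d (a : 'I_d -> 'rV[R]_n) j :
  \sum_i (i == j)%:R *: a i = a j.
Proof.
rewrite (bigD1 j) //= eqxx scale1r big1 ?addr0 // => i /negbTE ->.
by rewrite scale0r.
Qed.

Lemma vertex_conv d (a : 'I_d.+1 -> 'rV[R]_n) j : conv a (a j).
Proof.
by exists (fun i => (i == j)%:R); rewrite sum_delta sum_delta_scale.
Qed.

(** A vertex [a alpha_j] is a convex combination of the [b beta_k], and these
are convex combinations of the [a alpha_i].  By uniqueness of barycentric
coordinates the weight of [alpha_j] in [b beta_k] averages to [1] over the [k],
hence equals [1] for each [k] of positive weight. *)
Lemma dilated_vertex d d' (alpha : 'I_d.+1 -> 'rV[R]_n)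
    (beta : 'I_d'.+1 -> 'rV[R]_n) (a b : R) :
  affinely_independent alpha -> a != 0 ->
  dilate a (conv alpha) = dilate b (conv beta) ->
  forall j, exists k, a *: alpha j = b *: beta k.
Proof.
move=> alphaI a0 ab j.
have [_ [c [c0 c1 ->]] cE] : dilate b (conv beta) (a *: alpha j).
  by rewrite -ab; exists (alpha j) => //; exact: vertex_conv.
have /choice[e eP] k : exists e : 'I_d.+1 -> R,
    [/\ forall i, 0 <= e i, \sum_i e i = 1 &
        a *: \sum_i e i *: alpha i = b *: beta k].
  have : dilate a (conv alpha) (b *: beta k).
    by rewrite ab; exists (beta k) => //; exact: vertex_conv.
  by move=> [_ [f [f0 f1 ->]] fE]; exists f.
have avg1 : \sum_k c k * e k j = 1.
  have -> : 1 = (j == j)%:R :> R by rewrite eqxx.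
  apply: (@affinely_independent_coef _ alpha (fun i => \sum_k c k * e k i)
    (fun i => (i == j)%:R)) => //.
    rewrite exchange_big sum_delta /= -c1; apply: eq_bigr => k _.
    by have [_ e1 _] := eP k; rewrite -mulr_sumr e1 mulr1.
  rewrite sum_delta_scale; apply: (scalerI a0); rewrite -cE !scaler_sumr.
  under eq_bigr do rewrite scaler_suml scaler_sumr.
  rewrite exchange_big; apply: eq_bigr => k _ /=.
  have [_ _ ek] := eP k.
  rewrite scalerA mulrC -scalerA -ek 2!scaler_sumr; apply: eq_bigr => i _.
  by rewrite !scalerA; congr (_ *: _); ring.
have [k ck] : exists k, c k != 0.
  apply/existsP; apply: contraPT c1 => /existsPn cz; rewrite big1.
    by apply/eqP; rewrite eq_sym oner_eq0.
  by move=> k _; apply/eqP/negPn/cz.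
have defect0 : \sum_k c k * (1 - e k j) = 0.
  under eq_bigr do rewrite mulrBr mulr1.
  by rewrite sumrB c1 avg1 subrr.
exists k; have [e0 e1 <-] := eP k; congr (_ *: _); symmetry.
apply: convex_coef_eq1 => //.
have /psumr_eq0P/(_ defect0 k isT)/eqP : forall k, true -> 0 <= c k * (1 - e k j).
  move=> l _; have [l0 l1 _] := eP l.
  by rewrite mulr_ge0 // subr_ge0 convex_coef_le1.
by rewrite mulf_eq0 (negbTE ck) subr_eq0 => /eqP <-.
Qed.

End Barycentric.

Section Midpoints.
Variables (R : realType) (n : nat).

Lemma dilate2_Zpoints (x : 'rV[R]_n) : dilate 2 (@Zpoints R n) x -> Zpoints x.
Proof.
case=> y /mxOverP yZ <-; apply/mxOverP => i j.
by rewrite mxE rpredM ?natr_int.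
Qed.

(** The two even points are [2 u] and [2 (x - u)], where [u] is the combination
of the [beta_j] with the coefficients of a proper integral half; [p] and [q]
are their barycentric coordinates with respect to [alpha]. *)
Lemma lattice_point_Abar (M : nat) (alpha beta : 'I_n.+1 -> 'rV[R]_n)
    (x : 'rV[R]_n) :
  affinely_independent alpha -> (n <= M)%N -> (0 < M)%N ->
  (forall j, Zpoints (beta j)) ->
  (forall j, alpha j = (2 * M)%:R *: beta j) ->
  conv alpha x -> Zpoints x -> ~ range alpha x ->
  Abar (conv alpha `&` @Zpoints R n) x.
Proof.
move=> alphaI leqnM M0 betaZ alphaE [c [c0 c1 xE]] xZ xNv.
have MR0 : (M%:R : R) != 0 by rewrite pnatr_eq0 -lt0n.
have cN1 j : c j != 1.
  apply/eqP => cj1; apply: xNv; exists j => //.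
  by rewrite xE (@convex_coef_eq1 _ _ _ _ _ j).
have [g [gc sg [j0 gj0]]] := @proper_integral_half _ _ _ _ leqnM c0 c1 M0 cN1.
pose p j : R := (g j)%:R / M%:R; pose q j : R := 2 * c j - p j.
have sp : \sum_j p j = 1 by rewrite -mulr_suml -natr_sum sg divff.
have sq : \sum_j q j = 1 by rewrite sumrB -mulr_sumr c1 sp; ring.
have q0 j : 0 <= q j.
  rewrite subr_ge0 ler_pdivrMr ?ltr0n //.
  by apply: le_trans (gc j) _; rewrite natrM mulrAC.
pose u : 'rV[R]_n := \sum_j (g j)%:R *: beta j.
have uZ : Zpoints u.
  apply/mxOverP => k l; rewrite summxE rpred_sum // => j _.
  by rewrite mxE rpredM ?natr_int //; exact: (mxOverP (betaZ j)).
have sumpE : \sum_j p j *: alpha j = 2 *: u.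
  rewrite scaler_sumr; apply: eq_bigr => j _.
  by rewrite alphaE !scalerA natrM /p; congr (_ *: _); field.
have sumqE : \sum_j q j *: alpha j = 2 *: (x - u).
  under eq_bigr do rewrite scalerBl -scalerA.
  by rewrite sumrB -scaler_sumr -xE sumpE scalerBr.
have even2 y : Zpoints y -> dilate 2 (@Zpoints R n) (2 *: y).
  by move=> yZ; exists y.
have xuZ : Zpoints (x - u).
  by apply/mxOverP => k l; rewrite !mxE rpredB //; apply: mxOverP.
split=> //; exists (2 *: u), (2 *: (x - u)); split.
- split; last exact: even2.
  split; last exact/dilate2_Zpoints/even2.
  by exists p; split=> // j; rewrite divr_ge0.
- split; last exact: even2.
  split; last exact/dilate2_Zpoints/even2.
  by exists q; split.
- rewrite -sumpE -sumqE => pq.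
  have := @affinely_independent_coef _ _ _ _ _ _ alphaI (etrans sp (esym sq)) pq j0.
  rewrite /q => pj0; move/eqP: gj0; apply.
  have -> : c j0 = p j0 by lra.
  by rewrite mulrCA divff ?mulr1.
- by rewrite -scalerDr subrKC scalerA mulVf ?scale1r ?pnatr_eq0.
Qed.

End Midpoints.

Theorem corollary5p12 (R : realType) (n : nat) (alpha : 'I_n.+1 -> 'rV[R]_n)
    (alpha_even : forall j, dilate 2 (@Npoints R n) (alpha j))
    (alpha_indep : affinely_independent alpha)
    (M : nat) (leqnM : (n <= M)%N)
    (Delta' : set 'rV[R]_n) (Delta'_simplex : lattice_simplex Delta')
    (half_Delta : dilate 2^-1 (conv alpha) = dilate M%:R Delta') :
  H_simplex alpha.
Proof.
have alphaZ j : Zpoints (alpha j).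
  have [y yN <-] := alpha_even j; apply: dilate2_Zpoints; exists y => //.
  by apply: mxOverS yN; exact: intr_nat.
rewrite /H_simplex; apply/seteqP; split=> [x [L [LD _ _]] /LD//|x xD].
exists (conv alpha `&` @Zpoints R n) => //; split=> // {xD}x.
  by move=> [j _ <-]; split; [exact: vertex_conv|exact: alphaZ].
move=> [xD xZ]; have [xv|xNv] := pselect (range alpha x); [by right|left].
have M0 : (0 < M)%N.
  (* In dimension [0] the simplex is reduced to its vertex. *)
  case: (posnP n) => [n0|n0]; last exact: leq_trans n0 leqnM.
  exfalso; apply: xNv; exists ord0 => //.
  by apply/rowP => -[i lti]; exfalso; rewrite n0 in lti.
have [d [b [bZ _ Delta'E]]] := Delta'_simplex; rewrite Delta'E in half_Delta.
have /choice[s sP] := @dilated_vertex _ _ _ _ _ _ _ _ alpha_indep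
  (invr_neq0 (lt0r_neq0 (ltr0n R 2))) half_Delta.
apply: (@lattice_point_Abar _ _ M alpha (b \o s)) => // j; first exact: bZ.
by rewrite natrM -scalerA -sP scalerA divff ?scale1r ?pnatr_eq0.
Qed.
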